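(* Let $\mathbb Z\langle X\rangle$ be the free unital associative ring on the countably infinite set $X=\{x_1,x_2,\dots\}$, and let $T^{(4)}$ be the two-sided ideal of $\mathbb Z\langle X\rangle$ generated by all commutators $[a_1,a_2,a_3,a_4]$ with $a_i\in\mathbb Z\langle X\rangle$. For $k\ge 1$ put \[v_k=[x_1,x_2][x_3,x_4]\cdots[x_{2k-1},x_{2k}]\,[x_{2k+1},x_{2k+2},x_{2k+3}].\] Then $v_k\notin T^{(4)}$ for all $k\ge 1$.
   Context: Commutators are left-normed: $[a,b]=ab-ba$, $[a_1,\dots,a_n]=[[a_1,\dots,a_{n-1}],a_n]$. *)

(* Defs.v *)
(* The free unital associative ring Z<X>, X = {x_1, x_2, ...},
   is modelled concretely: an element is its coefficient function on words
   (words = seq nat, the letter i standing for the variable x_(i+1)),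
   required to have finite support. *)
From mathcomp Require Import all_boot all_order all_algebra.
Set Implicit Arguments. Unset Strict Implicit. Unset Printing Implicit Defensive.
Import Order.TTheory GRing.Theory Num.Theory.
Local Open Scope ring_scope.

Definition ncser := seq nat -> int.

Definition is_ncpoly (f : ncser) : Prop :=
  exists s : seq (seq nat), forall w, w \notin s -> f w = 0.

Definition nczero : ncser := fun _ => 0.
Definition ncone : ncser := fun w => if w is [::] then 1 else 0.
Definition ncadd (f g : ncser) : ncser := fun w => f w + g w.
Definition ncopp (f : ncser) : ncser := fun w => - f w.
Definition ncsub (f g : ncser) : ncser := ncadd f (ncopp g).
Definition ncmul (f g : ncser) : ncser :=
  fun w => \sum_(i < (size w).+1) f (take i w) * g (drop i w).

(* the generator x_i (i >= 1) is the word of one letter i.-1 *)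
Definition ncx (i : nat) : ncser :=
  fun w => if w == [:: i.-1] then 1 else 0.

Definition nccomm (a b : ncser) : ncser := ncsub (ncmul a b) (ncmul b a).
Definition nccomm3 (a1 a2 a3 : ncser) : ncser := nccomm (nccomm a1 a2) a3.
Definition nccomm4 (a1 a2 a3 a4 : ncser) : ncser :=
  nccomm (nccomm (nccomm a1 a2) a3) a4.

(* T^(4): the two-sided ideal of Z<X> generated by all [a1,a2,a3,a4],
   i.e. the set of finite sums of elements c * [a1,a2,a3,a4] * d
   (elements are compared extensionally, i.e. coefficientwise). *)
Inductive T4 : ncser -> Prop :=
  | T4_zero : T4 nczero
  | T4_gen c a1 a2 a3 a4 d :
      is_ncpoly c -> is_ncpoly a1 -> is_ncpoly a2 -> is_ncpoly a3 ->
      is_ncpoly a4 -> is_ncpoly d ->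
      T4 (ncmul (ncmul c (nccomm4 a1 a2 a3 a4)) d)
  | T4_add f g : T4 f -> T4 g -> T4 (ncadd f g)
  | T4_ext f g : T4 f -> (forall w, f w = g w) -> T4 g.

Fixpoint vprod (j : nat) : ncser :=
  match j with
  | 0 => ncone
  | j'.+1 => ncmul (vprod j') (nccomm (ncx (2 * j').+1) (ncx (2 * j').+2))
  end.

Definition v (k : nat) : ncser :=
  ncmul (vprod k) (nccomm3 (ncx (2 * k).+1) (ncx (2 * k).+2) (ncx (2 * k).+3)).

(* Main.v *)
Require Import Defs.
From mathcomp Require Import all_boot all_order all_algebra.
Set Implicit Arguments. Unset Strict Implicit. Unset Printing Implicit Defensive.
Import GRing.Theory.
Local Open Scope ring_scope.

(** Since 3 v_k lies in T^(4), a ring separating v_k from T^(4) must have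
    3-torsion.  Over F_3 take even elements X_i, Q and odd elements th_i, P with
    [X_i, X_j] = th_i th_j Q and [Q, X_i] = th_i P; the Jacobi identity holds
    because 3 th_i th_j th_k P = 0.  Normalised by QP = PQ = P, this makes v_k
    evaluate to -P th_1 ... th_(2k+3).

    On the ring generated by the X_i there are odd derivations N and D with
    N X_i = - th_i Q and D X_i = th_i, such that [a, X_j] = th_j N a and
    [N a, b] = D b D a P, while D a P commutes with every X_j.  Hence
    D [a, b] P = 0, so N [a, b, c] = 0, and [a, b, c] is central.

    The relations are realised by 3 x 3 matrices over 3 x 3 matrices over ...
    over F_3, each layer adding one pair X_m, th_m. *)

(** * Commutator identities in an arbitrary ring *)

Definition rcomm (R : nzRingType) (a b : R) : R := a * b - b * a.

Section Commutators.
Variable R : nzRingType.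

Lemma rcommMl (a b c : R) : rcomm (a * b) c = a * rcomm b c + rcomm a c * b.
Proof. by rewrite /rcomm mulrBr mulrBl !mulrA addrA subrK. Qed.

Lemma rcommMr (a b c : R) : rcomm a (b * c) = rcomm a b * c + b * rcomm a c.
Proof. by rewrite /rcomm mulrBr mulrBl !mulrA addrA subrK. Qed.

Lemma rcommBl (a b c : R) : rcomm (a - b) c = rcomm a c - rcomm b c.
Proof. by rewrite /rcomm mulrBl mulrBr !opprD addrACA. Qed.

Lemma rcommDl (a b c : R) : rcomm (a + b) c = rcomm a c + rcomm b c.
Proof. by rewrite /rcomm mulrDl mulrDr opprD addrACA. Qed.

Lemma rcommBr (a b c : R) : rcomm a (b - c) = rcomm a b - rcomm a c.
Proof. by rewrite /rcomm mulrBl mulrBr !opprD addrACA. Qed.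

Lemma rcommC (a b : R) : rcomm a b = - rcomm b a.
Proof. by rewrite /rcomm opprB. Qed.

Lemma rcomm0 (a b : R) : a * b = b * a -> rcomm a b = 0.
Proof. by rewrite /rcomm => ->; rewrite subrr. Qed.

Lemma rcomm_eq (a b : R) : rcomm a b = 0 -> a * b = b * a.
Proof. by move/eqP; rewrite subr_eq0 => /eqP. Qed.

End Commutators.

(** * Odd models, and the derivations N and D on the subring generated by the X_i *)

Record odd_model (R : nzRingType) (X th : nat -> R) (Q P : R) : Prop := OddModel {
  XX : forall i j, rcomm (X i) (X j) = th i * th j * Q;
  QX : forall i, rcomm Q (X i) = th i * P;
  thth : forall i j, th i * th j = - (th j * th i);
  thX : forall i j, th i * X j = X j * th i;
  thQ : forall i, th i * Q = Q * th i;
  thP : forall i, th i * P = - (P * th i);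
  XP : forall i, X i * P = P * X i;
  QP : Q * P = P;
  PQ : P * Q = P }.

(** [jet a n d] says that n = N a and d = D a; it is a relation because N and
    D need not be well defined on the ring itself. *)
Inductive jet (R : nzRingType) (X th : nat -> R) (Q : R) : R -> R -> R -> Prop :=
  | jet_gen i : jet X th Q (X i) (- (th i * Q)) (th i)
  | jet_one : jet X th Q 1 0 0
  | jet_sub a n d b m e : jet X th Q a n d -> jet X th Q b m e ->
      jet X th Q (a - b) (n - m) (d - e)
  | jet_mul a n d b m e : jet X th Q a n d -> jet X th Q b m e ->
      jet X th Q (a * b) (n * b + a * m) (d * b + a * e).

Section Jets.
Variables (R : nzRingType) (X th : nat -> R) (Q P : R).
Hypothesis M : odd_model X th Q P.
Local Notation J := (jet X th Q).

Lemma jet_rcomm a n d b m e : J a n d -> J b m e ->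
  J (rcomm a b) (rcomm n b + rcomm a m) (rcomm d b + rcomm a e).
Proof.
move=> ja jb.
have := jet_sub (jet_mul ja jb) (jet_mul jb ja).
by rewrite /rcomm !opprD !addrA !(addrAC _ _ (- (b * n))) !(addrAC _ _ (- (b * d))).
Qed.

(** Parity: the generators are even while N and D are odd, and the Leibniz rule preserves this.
    [jet_P] is the same sign rule against the odd element P. *)
Lemma jet_th a n d i : J a n d ->
  [/\ th i * a = a * th i, th i * n = - (n * th i) & th i * d = - (d * th i)].
Proof.
elim=> {a n d} [j||a n d b m e _ [ha hn hd] _ [hb hm he]
                 |a n d b m e _ [ha hn hd] _ [hb hm he]].
- split; [exact: thX M _ _ | | exact: thth M _ _].
  by rewrite mulrN mulNr mulrA (thth M) mulNr -!mulrA (thQ M).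
- by rewrite !mulr0 !mul0r oppr0 mulr1 mul1r.
- by rewrite !mulrBr !mulrBl ha hb hn hm hd he !opprD.
- by rewrite !mulrDr !mulrDl !mulrA ha hn hd !mulNr -!mulrA hb hm he !mulrN !opprD !mulrA.
Qed.

Lemma jet_P a n d : J a n d ->
  [/\ a * P = P * a, n * P = - (P * n) & d * P = - (P * d)].
Proof.
elim=> {a n d} [j||a n d b m e _ [ha hn hd] _ [hb hm he]
                 |a n d b m e _ [ha hn hd] _ [hb hm he]].
- split; [exact: XP M _ | | exact: thP M _].
  by rewrite mulrN mulNr -mulrA (QP M) opprK (thQ M) mulrA (PQ M) (thP M) opprK.
- by rewrite !mulr0 !mul0r oppr0 mulr1 mul1r.
- by rewrite !mulrBr !mulrBl ha hb hn hm hd he !opprD.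
- by rewrite !mulrDr !mulrDl -!mulrA hb hm he !mulrN !mulrA ha hn hd !mulNr !opprD ?mulrA.
Qed.

(** N and -D differ by a factor Q on generators, and QP = P absorbs it. The Leibniz rule carries
    this to products because P commutes with even elements. *)
Lemma jet_nP a n d : J a n d -> n * P = - (d * P).
Proof.
elim=> {a n d} [j||a n d b m e ja hn jb hm|a n d b m e ja hn jb hm].
- by rewrite mulNr -mulrA (QP M).
- by rewrite !mul0r oppr0.
- by rewrite !mulrBl hn hm opprD.
- have [hb _ _] := jet_P jb.
  by rewrite !mulrDl -(mulrA n) -(mulrA d) hb !mulrA hn -(mulrA a m) hm mulrN mulNr opprD !mulrA.
Qed.

(** The three claims are proved by one induction, since the product case of each uses the earlier
    ones. *)
Lemma jet_X a n d j : J a n d ->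
  [/\ rcomm a (X j) = th j * n, rcomm n (X j) = th j * (d * P) & rcomm (d * P) (X j) = 0].
Proof.
elim=> {a n d} [i||a n d b m e ja [a1 a2 a3] jb [b1 b2 b3]
                  |a n d b m e ja [a1 a2 a3] jb [b1 b2 b3]].
- split.
  + by rewrite (XX M) mulrN mulrA (thth M) mulNr.
  + rewrite -mulNr rcommMl (QX M) (rcomm0 (a := - th i)); last first.
      by rewrite mulNr mulrN (thX M).
    by rewrite mul0r addr0 mulNr !mulrA (thth M i j) !mulNr opprK.
  + by rewrite rcommMl rcomm0 ?(XP M)// mulr0 add0r rcomm0 ?mul0r // (thX M).
- by rewrite !mul0r !mulr0; split; apply: rcomm0; rewrite ?mul1r ?mulr1 ?mul0r ?mulr0.
- by rewrite !mulrBl !rcommBl a1 a2 a3 b1 b2 b3 !mulrBr subr0.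
- have [ta tn td] := jet_th j ja; have [tb tm te] := jet_th j jb.
  have [pa pn pd] := jet_P ja; have [pb pm pe] := jet_P jb.
  split.
  + by rewrite rcommMl a1 b1 !mulrDr !mulrA ta addrC.
  + rewrite rcommDl !rcommMl a1 a2 b1 b2 mulrDl mulrDr -(mulrA d b) pb !mulrA.
    (* The cross terms [n * th j * m] and [th j * n * m] cancel because n is odd. *)
    rewrite -[n * th j]opprK -tn mulNr -ta.
    by rewrite [X in X + _]addrC addrACA addNr addr0 .
  + have -> : (d * b + a * e) * P = d * P * b + a * (e * P).
      by rewrite mulrDl -!mulrA pb.
    rewrite rcommDl (rcommMl (d * P)) (rcommMl a) a1 a3 b1 b3 mul0r mulr0 addr0 add0r.
    (* What remains is th_j (d P m + n e P); by [jet_nP] and oddness the two summands are -d P e and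
       d P e. *)
    have -> : d * P * (th j * m) = th j * (d * P * m).
      by rewrite !mulrA td !mulNr -(mulrA d P) -(mulrA d (th j)) (thP M) mulrN !mulNr opprK.
    rewrite -(mulrA (th j) n) -mulrDr.
    have -> : n * (e * P) = d * P * e by rewrite pe mulrN mulrA (jet_nP ja) mulNr opprK.
    have -> : d * P * m = - (d * P * e).
      have Pm : P * m = - (P * e) by rewrite -[P * m]opprK -pm (jet_nP jb) opprK pe.
      by rewrite -mulrA Pm mulrN mulrA.
    by rewrite addNr mulr0.
Qed.

Lemma jet_centralizes u a n d : (forall j, rcomm u (X j) = 0) -> J a n d -> rcomm u a = 0.
Proof.
move=> uX; elim=> {a n d} [j||a n d b m e _ ha _ hb|a n d b m e _ ha _ hb].
- exact: uX.
- by rewrite /rcomm mulr1 mul1r subrr.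
- by rewrite rcommBr ha hb subrr.
- by rewrite rcommMr ha hb mul0r mulr0 addr0.
Qed.

(** For fixed a, both sides are derivations in b: the right one because D a P commutes with every
    X_j, hence with all their polynomials. They agree on generators by [jet_X]. *)
Lemma jet_rcomm_nabla a n d b m e : J a n d -> J b m e -> rcomm n b = e * (d * P).
Proof.
move=> ja; have dPX j : rcomm (d * P) (X j) = 0 by case: (jet_X j ja).
elim=> {b m e} [j||b m e c l f jb hb jc hc|b m e c l f jb hb jc hc].
- by case: (jet_X j ja).
- by rewrite /rcomm mulr1 mul1r subrr mul0r.
- by rewrite rcommBr hb hc mulrBl.
- by rewrite rcommMr hb hc mulrDl -(mulrA e (d * P)) (rcomm_eq (jet_centralizes dPX jc)) !mulrA.
Qed.

(** As a and b commute with P, the left side is [D a P, b] - [D b P, a], and both commutators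
    vanish. *)
Lemma jet_rcomm_dP a n d b m e : J a n d -> J b m e ->
  (rcomm d b + rcomm a e) * P = 0.
Proof.
move=> ja jb; have [pa _ pd] := jet_P ja; have [pb _ pe] := jet_P jb.
have dPb : rcomm (d * P) b = 0 by apply: (jet_centralizes _ jb) => j; case: (jet_X j ja).
have ePa : rcomm (e * P) a = 0 by apply: (jet_centralizes _ ja) => j; case: (jet_X j jb).
have -> : (rcomm d b + rcomm a e) * P = rcomm (d * P) b - rcomm (e * P) a.
  by rewrite /rcomm mulrDl !mulrBl opprB -!mulrA pa pb !mulrA.
by rewrite dPb ePa subrr.
Qed.

Lemma jet_lie_nilpotent a n d b m e c l f x y z :
  J a n d -> J b m e -> J c l f -> J x y z -> rcomm (rcomm (rcomm a b) c) x = 0.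
Proof.
move=> ja jb jc jx; have jw := jet_rcomm ja jb; have wP := jet_rcomm_dP ja jb.
apply: (jet_centralizes _ jx) => j; have [-> _ _] := jet_X j (jet_rcomm jw jc).
have [_ _ pf] := jet_P jc.
(* With w = [a, b], N[w, c] = [N w, c] - [N c, w] = D c (D w P) - D w (D c P). Moving P left past
   the odd D c exposes the vanishing factor D w P in both terms. *)
rewrite (rcommC _ l) (jet_rcomm_nabla jw jc) (jet_rcomm_nabla jc jw) wP mulr0.
by rewrite pf mulrN mulrA wP mul0r !oppr0 addr0 mulr0.
Qed.

End Jets.

(** Y is the coefficient through which the next variable X_m = x + th_m Y will
    act on the previous ones, and g implements the parity automorphism, so that
    g times a fresh square-zero element is an odd th_m. *)
Record extensible_model (R : nzRingType) (m : nat) (X th : nat -> R) (Q P Y g : R) : Prop :=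
  ExtensibleModel {
  ext_model : odd_model X th Q P;
  YX : forall i, rcomm Y (X i) = th i * Q;
  QY : rcomm Q Y = P;
  PY : P * Y = - (Y * P);
  thY : forall i, th i * Y = - (Y * th i);
  gg : g * g = 1;
  gX : forall i, g * X i = X i * g;
  gth : forall i, g * th i = - (th i * g);
  gQ : g * Q = Q * g;
  gP : g * P = - (P * g);
  gY : g * Y = - (Y * g);
  X0 : forall i, (m <= i)%N -> X i = 0;
  th0 : forall i, (m <= i)%N -> th i = 0;
  char3 : 3%:R = 0 :> R;
  top_neq0 : P * \prod_(i < m) th i != 0 }.

(** * Construction of models by 3 x 3 matrices over a noncommutative ring *)

Section Units.
Variable R : nzRingType.
Local Notation E i j := (delta_mx i j : 'M[R]_3).

Definition i0 : 'I_3 := @Ordinal 3 0 isT.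
Definition i1 : 'I_3 := @Ordinal 3 1 isT.
Definition i2 : 'I_3 := @Ordinal 3 2 isT.
(** Conjugation by this involution negates the off-diagonal units in row or column [i], so it
    extends the parity automorphism to matrices. *)
Definition sgn i : 'M[R]_3 := 1 - E i i *+ 2.

(** For such matrices the coefficients multiply separately from the matrices ([scaleM]), as in a
    tensor product of R with integer matrices, although R is noncommutative. *)
Definition scalar_entries (e : 'M[R]_3) := forall i j (b : R), e i j * b = b * e i j.

Lemma scalar_delta i j : scalar_entries (delta_mx i j).
Proof. by move=> k l b; rewrite mxE; exact: commr_sym (commr_nat _ _). Qed.

Lemma scalar_one : scalar_entries 1.
Proof. by move=> k l b; rewrite mxE; exact: commr_sym (commr_nat _ _). Qed.

Lemma scalar_sgn i : scalar_entries (sgn i).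
Proof.
move=> k l b; rewrite !mxE mulrBl mulrBr; congr (_ - _); first exact: (commr_sym (commr_nat _ _)).
rewrite -natrD; exact: (commr_sym (commr_nat _ _)).
Qed.

Lemma scaleM (a b : R) (e f : 'M[R]_3) : scalar_entries e ->
  (a *: e) * (b *: f) = (a * b) *: (e * f).
Proof.
move=> he; rewrite -scalerAl -scalerA; congr (_ *: _).
apply/matrixP=> i j; rewrite !mxE mulr_sumr; apply: eq_bigr => k _.
by rewrite !mxE !mulrA he.
Qed.

Lemma deltaM i j k : E i j * E j k = E i k. Proof. exact: mul_delta_mx. Qed.

Lemma deltaM0 i j k l : j != k -> E i j * E k l = 0.
Proof. by move=> jk; exact: mul_delta_mx_0. Qed.

Lemma sgn_sgn i : sgn i * sgn i = 1.
Proof.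
rewrite /sgn mulrBl mul1r mulrBr mulr1 mulrnAl mulrnAr deltaM.
by rewrite [_ *+ 2 *+ 2]mulr2n opprB addrK subrK.
Qed.

Lemma sgn_delta i j k : sgn i * E j k = if i == j then - E j k else E j k.
Proof.
rewrite mulrBl mul1r mulrnAl; case: eqP => [->|/eqP ij].
  by rewrite deltaM mulr2n opprD addrA subrr add0r.
by rewrite deltaM0 // mul0rn subr0.
Qed.

Lemma delta_sgn i j k : E j k * sgn i = if k == i then - E j k else E j k.
Proof.
rewrite mulrBr mulr1 mulrnAr; case: eqP => [->|/eqP ij].
  by rewrite deltaM mulr2n opprD addrA subrr add0r.
by rewrite deltaM0 // mul0rn subr0.
Qed.

End Units.

(** With no variables yet, the core relation is [Q, Y] = P, which is [E01, E12] = E02 for matrix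
    units. Adding 1 to E01 gives QP = PQ = P without changing commutators. *)
Lemma base_model (F : nzRingType) : 3%:R = 0 :> F ->
  exists (R : nzRingType) (X th : nat -> R) (Q P Y g : R),
  extensible_model 0 X th Q P Y g.
Proof.
move=> F3; exists 'M[F]_3, (fun=> 0), (fun=> 0), (1 + delta_mx i0 i1),
  (delta_mx i0 i2), (delta_mx i1 i2), (sgn _ i2).
split=> //; try by move=> i; rewrite /rcomm ?(mulr0, mul0r, oppr0, subr0).
- by split=> *; rewrite /rcomm ?(mulr0, mul0r, oppr0, subr0, mulrDl, mulrDr, mul1r, mulr1) //
     deltaM0 ?addr0.
- by rewrite /rcomm mulrDl mulrDr deltaM deltaM0 // mul1r mulr1 addr0 addrC addKr.
- by rewrite !deltaM0 ?oppr0.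
- exact: sgn_sgn.
- by rewrite [LHS]mulrDr [RHS]mulrDl sgn_delta delta_sgn mulr1 mul1r.
- by rewrite sgn_delta delta_sgn /= opprK.
- by rewrite sgn_delta delta_sgn /= opprK.
- by rewrite -[3%:R]scaler_nat F3 scale0r.
- rewrite big_ord0 mulr1; apply/negP => /eqP/matrixP/(_ i0 i2).
  by rewrite !mxE !eqxx => /eqP; rewrite oner_eq0.
Qed.

(** Here x = E12 and the fresh square-zero element is E02. Old elements become scalar matrices,
    which commute with E12, so they see X_m only through th_m Y; E12 itself matters only against the
    E01 term of the next Y. *)
Definition extX (R : nzRingType) m (X : nat -> R) (Y g : R) i : 'M[R]_3 :=
  if i == m then delta_mx i1 i2 + (g * Y) *: delta_mx i0 i2 else X i *: 1.
Definition extth (R : nzRingType) m (th : nat -> R) (g : R) i : 'M[R]_3 :=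
  if i == m then g *: delta_mx i0 i2 else th i *: 1.

Lemma scale11 (R : nzRingType) (a b : R) (e : 'M[R]_3) : (a *: 1) * (b *: e) = (a * b) *: e.
Proof. by rewrite scaleM ?mul1r //; exact: scalar_one. Qed.

Lemma scalee1 (R : nzRingType) (a b : R) (e : 'M[R]_3) : scalar_entries e ->
  (a *: e) * (b *: 1) = (a * b) *: e.
Proof. by move=> he; rewrite scaleM ?mulr1. Qed.

Lemma ext_odd_model (R : nzRingType) m (X th : nat -> R) (Q P Y g : R) :
  extensible_model m X th Q P Y g ->
  odd_model (extX m X Y g) (extth m th g) (Q *: 1) (P *: 1).
Proof.
move=> M; have M0 := ext_model M.
have sE := @scalar_delta R; have s1 := @scalar_one R.
have rX j : rcomm (delta_mx i1 i2 + (g * Y) *: delta_mx i0 i2) (X j *: 1)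
    = (g * th j * Q) *: delta_mx i0 i2.
  rewrite rcommDl -[X in rcomm X _]scale1r /rcomm !scalee1 // !scale11 mul1r mulr1 subrr add0r.
  by rewrite -scalerBl -[_ - _]/(rcomm _ _) rcommMl (rcomm0 (gX M _)) mul0r addr0 (YX M) mulrA.
have gthQ j : g * th j * Q = - (th j * g * Q) by rewrite (gth M) mulNr.
split; rewrite /extX /extth.
- move=> i j; case: eqP => _; case: eqP => _.
  + by rewrite scaleM // deltaM0 // scaler0 mul0r /rcomm subrr.
  + by rewrite rX !scalee1.
  + by rewrite rcommC rX scale11 scalee1 // gthQ scaleNr opprK.
  + by rewrite /rcomm !scale11 -scalerBl -(XX M0).
- move=> i; case: eqP => _.
  + rewrite rcommC rcommDl -[X in rcomm X _]scale1r /rcomm !scalee1 // !scale11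
      mul1r mulr1 subrr add0r.
    by rewrite -scalerBl -[_ - _]/(rcomm _ _) -scaleNr -rcommC rcommMr (rcomm0 (esym (gQ M)))
       mul0r add0r (QY M).
  + by rewrite /rcomm !scale11 -scalerBl -(QX M0).
- move=> i j; case: eqP => _; case: eqP => _.
  + by rewrite scaleM // deltaM0 // scaler0 oppr0.
  + by rewrite scalee1 // scale11 (gth M) scaleNr.
  + by rewrite scalee1 // scale11 (gth M) scaleNr opprK.
  + by rewrite !scale11 (thth M0) scaleNr.
- move=> i j; case: eqP => _; case: eqP => _.
  + by rewrite mulrDr mulrDl -[delta_mx i1 i2]scale1r !scaleM // !deltaM0 // !scaler0.
  + by rewrite scalee1 // scale11 (gX M).
  + rewrite mulrDr mulrDl -[delta_mx i1 i2]scale1r !scale11 !scalee1 // mulr1 mul1r.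
    by rewrite mulrA -[th i * g]opprK -(gth M) mulNr -(mulrA g (th i)) (thY M) mulrN opprK mulrA.
  + by rewrite !scale11 (thX M0).
- move=> i; case: eqP => _; first by rewrite scalee1 // scale11 (gQ M).
  by rewrite !scale11 (thQ M0).
- move=> i; case: eqP => _; first by rewrite scalee1 // scale11 (gP M) scaleNr.
  by rewrite !scale11 (thP M0) scaleNr.
- move=> i; case: eqP => _; last by rewrite !scale11 (XP M0).
  rewrite mulrDr mulrDl -[delta_mx i1 i2]scale1r !scale11 !scalee1 // mulr1 mul1r.
  by rewrite mulrA -[P * g]opprK -(gP M) mulNr -!mulrA (PY M) mulrN opprK.
- by rewrite scale11 (QP M0).
- by rewrite scale11 (PQ M0).
Qed.

(** The correction to Y restores [Y, X_m] = th_m Q: without it this commutator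
    is -2 th_m Y^2, which is th_m Y^2 in characteristic 3, and Q - Y^2 commutes
    with the old variables. *)
Lemma ext_model_step (R : nzRingType) m (X th : nat -> R) (Q P Y g : R) :
  extensible_model m X th Q P Y g ->
  extensible_model m.+1 (extX m X Y g) (extth m th g) (Q *: 1) (P *: 1)
    (Y *: 1 + (g * (Q - Y * Y)) *: delta_mx i0 i1) (g *: sgn R i0).
Proof.
move=> M; have M0 := ext_model M.
have sE := @scalar_delta R; have s1 := @scalar_one R; have ss := @scalar_sgn R.
have gYY : g * (Y * Y) = Y * Y * g.
  by rewrite mulrA (gY M) mulNr -(mulrA Y g) (gY M) mulrN opprK mulrA.
have thYY i : th i * (Y * Y) = Y * Y * th i.
  by rewrite mulrA (thY M) mulNr -(mulrA Y (th i)) (thY M) mulrN opprK mulrA.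
have PYY : P * (Y * Y) = Y * Y * P.
  by rewrite mulrA (PY M) mulNr -(mulrA Y P) (PY M) mulrN opprK mulrA.
set Z := Q - Y * Y.
have gZ : g * Z = Z * g by rewrite mulrBr mulrBl (gQ M) gYY.
have thZ i : th i * Z = Z * th i by rewrite mulrBr mulrBl (thQ M0) thYY.
have PZ : P * Z = Z * P by rewrite mulrBr mulrBl (PQ M0) (QP M0) PYY.
have QZ : rcomm Q Z = 0.
  by rewrite rcommBr rcommMr (QY M) (PY M) addNr (rcomm0 (erefl (Q * Q))) subr0.
(* [Y^2, X_i] = Y th_i Q + th_i Q Y = th_i [Q, Y] = th_i P, which equals [Q, X_i]. *)
have ZX i : rcomm Z (X i) = 0.
  rewrite rcommBl (rcommMl Y) (QX M0) !(YX M) -[RHS](subrr (th i * P)); congr (_ - _).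
  rewrite mulrA -[Y * th i]opprK -(thY M) mulNr -!mulrA addrC -mulrBr.
  by rewrite -[_ - _]/(rcomm Q Y) (QY M).
(* The left side is the E02 coefficient of the commutator of the new Y with X_m. It equals gQ -
   3gY^2, and characteristic 3 removes the last term. *)
have gZ_YgY : g * Z + (Y * (g * Y) - g * Y * Y) = g * Q.
  rewrite mulrBr mulrA mulrA -[Y * g]opprK -(gY M) mulNr -addrA -[RHS]addr0; congr (_ + _).
  by rewrite -!opprD -[X in X + _]mulr1n -mulr2n -mulrnDr -mulr_natr (char3 M) mulr0 oppr0.
clearbody Z.
split.
- exact: ext_odd_model.
- move=> i; rewrite /extX /extth; case: eqP => _.
  + rewrite /rcomm !mulrDr !mulrDl -[delta_mx i1 i2]scale1r !scale11 !scalee1 // !scaleM //.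
    rewrite !deltaM !(@deltaM0 R i1 i2 i0) // !(@deltaM0 R i0 i2 i0) // !scaler0.
    by rewrite deltaM0 // scaler0 !addr0 mulr1 mul1r opprD -(addrA (Y *: _)) addrACA subrr add0r
       -!scalerDl (mulr1 (g * Z)) -scalerBl -addrA gZ_YgY.
  + rewrite rcommDl /rcomm !scalee1 // !scale11 -!scalerBl -!/(rcomm _ _) (YX M).
    by rewrite rcommMl ZX (rcomm0 (gX M i)) mul0r mulr0 addr0 scale0r addr0.
- rewrite rcommC rcommDl /rcomm !scalee1 // !scale11 -!scalerBl -!/(rcomm _ _).
  rewrite rcommMl (rcomm0 (gQ M)) mul0r addr0 [rcomm Z _]rcommC QZ oppr0 mulr0 scale0r addr0.
  by rewrite -scaleNr -rcommC (QY M).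
- rewrite mulrDr mulrDl !scalee1 // !scale11 (PY M) scaleNr opprD; congr (_ + _).
  by rewrite mulrA -[P * g]opprK -(gP M) mulNr -!mulrA PZ scaleNr.
- move=> i; rewrite /extth; case: eqP => _.
  + by rewrite mulrDr mulrDl !scalee1 // !scale11 !scaleM // !deltaM0 // !scaler0 !addr0 (gY M) scaleNr.
  + rewrite mulrDr mulrDl !scalee1 // !scale11 (thY M) scaleNr opprD; congr (_ + _).
    by rewrite mulrA -[th i * g]opprK -(gth M) mulNr -!mulrA thZ scaleNr.
- by rewrite scaleM // sgn_sgn (gg M) scale1r.
- move=> i; rewrite /extX; case: eqP => _; last by rewrite scale11 scalee1 // (gX M).
  rewrite mulrDr mulrDl -[delta_mx i1 i2]scale1r !scaleM // !sgn_delta !delta_sgn /= mulr1 mul1r.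
  by rewrite -(mulrA g Y g) -[Y * g]opprK -(gY M) mulrN scaleNr scalerN.
- move=> i; rewrite /extth; case: eqP => _; last by rewrite scale11 scalee1 // (gth M) scaleNr.
  by rewrite !scaleM // sgn_delta delta_sgn /= scalerN.
- by rewrite scale11 scalee1 // (gQ M).
- by rewrite scale11 scalee1 // (gP M) scaleNr.
- rewrite mulrDr mulrDl !scaleM // mulr1 mul1r sgn_delta delta_sgn /= (gY M) scaleNr scalerN opprD.
  by rewrite -mulrA gZ.
- by move=> i mi; rewrite /extX gtn_eqF // (X0 M) ?scale0r // ltnW.
- by move=> i mi; rewrite /extth gtn_eqF // (th0 M) ?scale0r // ltnW.
- by rewrite -[3%:R]scaler_nat (char3 M) scale0r.
- rewrite big_ord_recr /= {2}/extth eqxx.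
  have -> : \prod_(i < m) extth m th g i = (\prod_(i < m) th i) *: 1.
    transitivity (\prod_(i < m) (th i *: (1 : 'M[R]_3))).
      by apply: eq_bigr => i _; rewrite /extth ltn_eqF.
    by elim/big_rec2: _ => [|i y1 y2 _ ->]; rewrite ?scale1r // scale11.
  (* The (0,2) entry is P th_0 ... th_(m-1) g; multiplying by g on the right cancels g since g^2 =
     1. *)
  rewrite !scale11; apply/negP => /eqP/matrixP/(_ i0 i2); rewrite !mxE !eqxx mulr1 mulrA => zero.
  move/(congr1 ( *%R^~ g)): zero; rewrite /= -mulrA (gg M) mulr1 mul0r => zero.
  by have := top_neq0 M; rewrite zero eqxx.
Qed.

Lemma exists_extensible_model m : exists (R : nzRingType) (X th : nat -> R) (Q P Y g : R),
  extensible_model m X th Q P Y g.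
Proof.
elim: m => [|m [R [X [th [Q [P [Y [g M]]]]]]]].
  by apply: (@base_model 'F_3); exact: pchar_Fp_0.
by do 7!eexists; exact: ext_model_step M.
Qed.

(** * Evaluation of noncommutative polynomials in a ring *)

Section Evaluation.
Variables (R : nzRingType) (X : nat -> R).

Definition word_value (w : seq nat) : R := \prod_(i <- w) X i.

Definition supported (s : seq (seq nat)) (f : ncser) := forall w, w \notin s -> f w = 0.

(** Substitution of X i for the letter i, that is, for x_(i+1). It is a relation because a finite
    support is only known to exist; [evaluates_uniq] shows that its choice is immaterial. *)
Definition evaluates (f : ncser) (b : R) := exists s,
  [/\ uniq s, supported s f & b = \sum_(w <- s) word_value w *~ f w].

Lemma sum_supported s t (f : ncser) (F : seq nat -> R) : uniq s -> uniq t -> supported s f ->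
  {subset s <= t} -> \sum_(w <- t) F w *~ f w = \sum_(w <- s) F w *~ f w.
Proof.
move=> us ut sf st; rewrite (bigID (mem s)) /= [X in _ + X]big1 ?addr0 => [|w /sf->]; last exact: mulr0z.
rewrite -big_filter; apply/perm_big/uniq_perm => // [|w]; first exact: filter_uniq.
by rewrite mem_filter andb_idr // => /st.
Qed.

Lemma evaluates_uniq f b c : evaluates f b -> evaluates f c -> b = c.
Proof.
move=> [s [us sf ->]] [t [ut tf ->]].
have ust : uniq (undup (s ++ t)) by exact: undup_uniq.
rewrite -(sum_supported word_value us ust sf) => [|w ws]; last by rewrite mem_undup mem_cat ws.
by apply: sum_supported => // w wt; rewrite mem_undup mem_cat wt orbT.
Qed.

Lemma evaluates_ext f h b : evaluates f b -> (forall w, f w = h w) -> evaluates h b.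
Proof.
move=> [s [us sf ->]] fh; exists s; split=> // [w /sf|]; first by rewrite fh.
by apply: eq_bigr => w _; rewrite fh.
Qed.

Lemma ncpoly_evaluates f : is_ncpoly f -> exists b, evaluates f b.
Proof.
move=> [s sf]; exists (\sum_(w <- undup s) word_value w *~ f w), (undup s).
by split=> // [|w]; rewrite ?undup_uniq // mem_undup => /sf.
Qed.

Lemma evaluates_add f h b c : evaluates f b -> evaluates h c -> evaluates (ncadd f h) (b + c).
Proof.
move=> [s [us sf ->]] [t [ut tf ->]].
have ust : uniq (undup (s ++ t)) by exact: undup_uniq.
exists (undup (s ++ t)); split=> // [w|].
  by rewrite mem_undup mem_cat negb_or => /andP[/sf fw /tf hw]; rewrite /ncadd fw hw.
rewrite -(sum_supported word_value us ust sf) => [|w ws]; last by rewrite mem_undup mem_cat ws.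
rewrite -(sum_supported word_value ut ust tf) => [|w wt]; last by rewrite mem_undup mem_cat wt orbT.
by rewrite -big_split; apply: eq_bigr => w _; rewrite /= -mulrzDr.
Qed.

Lemma evaluates_opp f b : evaluates f b -> evaluates (ncopp f) (- b).
Proof.
move=> [s [us sf ->]]; exists s; split=> // [w /sf fw|]; first by rewrite /ncopp fw oppr0.
by rewrite -sumrN; apply: eq_bigr => w _; rewrite -mulrNz.
Qed.

(** A factorisation u ++ v = w is a cut of w at position [size u], so the convolution can be indexed
    by pairs of support words. *)
Lemma big_splittings (G : seq nat -> seq nat -> R) s t w : uniq s -> uniq t ->
  (forall u v, (u \notin s) || (v \notin t) -> G u v = 0) ->
  \sum_(i < (size w).+1) G (take i w) (drop i w) =
  \sum_(u <- s) \sum_(v <- t | u ++ v == w) G u v.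
Proof.
move=> us ut G0.
have big_eq r a (F : seq nat -> R) : uniq r -> (a \notin r -> F a = 0) ->
    \sum_(u <- r | u == a) F u = F a.
  move=> ur F0; have [ar|ar] := boolP (a \in r).
    by rewrite -big_filter (filter_pred1_uniq ur ar) big_seq1.
  by rewrite F0 // big_seq_cond big1 // => u /andP[uin /eqP ua]; rewrite ua (negPf ar) in uin.
transitivity (\sum_(i < (size w).+1) \sum_(u <- s | u == take i w)
    \sum_(v <- t | v == drop i w) G u v).
  apply: eq_bigr => i _; rewrite big_eq // => [|si]; first by rewrite big_eq // => ti; rewrite G0 ?ti ?orbT.
  by rewrite big1 // => v _; rewrite G0 ?si.
rewrite (exchange_big_dep predT) //=; apply: eq_bigr => u _.
rewrite (exchange_big_dep predT) //= [RHS]big_mkcond; apply: eq_bigr => v _.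
case: eqP => uvw.
  have lt : (size u < (size w).+1)%N by rewrite -uvw ltnS size_cat leq_addr.
  rewrite (big_pred1 (Ordinal lt)) // => i /=.
  apply/andP/eqP => [[/eqP ui _]|->]; last by rewrite /= -uvw take_size_cat // drop_size_cat.
  apply/val_inj; rewrite /= (congr1 size ui) size_take_min.
  by apply/esym/minn_idPl; rewrite -ltnS.
by rewrite big_pred0 // => i; apply/andP => -[/eqP ui /eqP vi]; case: uvw; rewrite ui vi cat_take_drop.
Qed.

Lemma word_value_cat u v : word_value (u ++ v) = word_value u * word_value v.
Proof. exact: big_cat. Qed.

Lemma evaluates_mul f h b c : evaluates f b -> evaluates h c -> evaluates (ncmul f h) (b * c).
Proof.
move=> [s [us sf ->]] [t [ut tf ->]].
pose r := undup [seq u ++ v | u <- s, v <- t].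
have fh0 u v : (u \notin s) || (v \notin t) -> f u * h v = 0.
  by case/orP => [/sf|/tf] ->; rewrite ?mul0r ?mulr0.
exists r; split; first exact: undup_uniq.
  move=> w wr; rewrite /ncmul big1 // => i _; apply: fh0; rewrite -negb_and.
  apply: contra wr => /andP[si ti]; rewrite mem_undup.
  by apply/allpairsP; exists (take i w, drop i w); rewrite /= cat_take_drop.
(* The product of the two sums is grouped by the concatenated word, which matches the coefficients
   of [ncmul]. *)
transitivity (\sum_(w <- r) \sum_(u <- s) \sum_(v <- t | u ++ v == w)
    word_value (u ++ v) *~ (f u * h v)); last first.
  apply: eq_bigr => w _; rewrite /ncmul.
  rewrite -(@big_splittings (fun u v => word_value (u ++ v) *~ (f u * h v))) //; last first.
    by move=> u v /fh0 ->; exact: mulr0z.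
  by rewrite mulrz_sumr; apply: eq_bigr => i _; rewrite cat_take_drop.
rewrite exchange_big big_distrl /=; apply: eq_big_seq => u su.
rewrite (exchange_big_dep predT) //= big_distrr /=; apply: eq_big_seq => v tv.
rewrite (eq_bigl (pred1 (u ++ v))); last by move=> w; rewrite /= eq_sym.
have uvr : u ++ v \in r by rewrite mem_undup; apply/allpairsP; exists (u, v).
by rewrite -big_filter (filter_pred1_uniq (undup_uniq _) uvr) big_seq1 word_value_cat mulrzAl
   mulrzAr mulrzA mulrzAC.
Qed.

Lemma evaluates_one : evaluates ncone 1.
Proof.
exists [:: [::]]; split=> // [[]//|].
by rewrite big_seq1 /word_value big_nil.
Qed.

Lemma evaluates_ncx i : evaluates (ncx i.+1) (X i).
Proof.
exists [:: [:: i]]; split=> // [w|]; first by rewrite inE /ncx => /negPf->.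
by rewrite big_seq1 /word_value big_seq1 /ncx eqxx.
Qed.

Lemma evaluates_zero : evaluates nczero 0.
Proof. by exists [::]; split; rewrite ?big_nil. Qed.

Lemma evaluates_comm f h b c : evaluates f b -> evaluates h c ->
  evaluates (nccomm f h) (rcomm b c).
Proof. by move=> fb hc; apply/evaluates_add/evaluates_opp; exact: evaluates_mul. Qed.

End Evaluation.

(** * Values of T^(4) and of v_k in a model *)

Section Conclusion.
Variables (R : nzRingType) (X th : nat -> R) (Q P : R).
Hypothesis M : odd_model X th Q P.

Lemma jet_zero : jet X th Q 0 0 0.
Proof. by have := jet_sub (jet_one X th Q) (jet_one X th Q); rewrite !subrr. Qed.

Lemma jet_add a n d b m e : jet X th Q a n d -> jet X th Q b m e ->
  jet X th Q (a + b) (n + m) (d + e).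
Proof.
by move=> ja jb; have := jet_sub ja (jet_sub jet_zero jb); rewrite !sub0r !opprK.
Qed.

Lemma jet_mulrz a n d z : jet X th Q a n d -> jet X th Q (a *~ z) (n *~ z) (d *~ z).
Proof.
move=> ja; have jn k : jet X th Q (a *+ k) (n *+ k) (d *+ k).
  by elim: k => [|k IH]; [exact: jet_zero | rewrite !mulrS; exact: jet_add].
case: z => k; first exact: jn.
by have := jet_sub jet_zero (jn k.+1); rewrite !sub0r.
Qed.

(** Values of integer polynomials lie in the subring generated by the X_i, where jets exist. *)
Lemma evaluates_jet f b : evaluates X f b -> exists n d, jet X th Q b n d.
Proof.
move=> [s [_ _ ->]]; elim/big_rec: _ => [|w b' _ [n [d jb]]].
  by do 2!eexists; exact: jet_zero.
have [m [e jw]] : exists m e, jet X th Q (word_value X w) m e.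
  elim: w => [|i w [m [e jw]]]; rewrite /word_value ?big_nil ?big_cons.
    by do 2!eexists; exact: jet_one.
  by do 2!eexists; apply: jet_mul jw; exact: jet_gen.
by do 2!eexists; apply: jet_add jb; exact: jet_mulrz jw.
Qed.

Lemma T4_evaluates f : T4 f -> evaluates X f 0.
Proof.
elim=> {f} [|c a1 a2 a3 a4 d pc p1 p2 p3 p4 pd|f h _ ef _ eh|f h _ ef fh].
- exact: evaluates_zero.
- have [c' ec] := ncpoly_evaluates X pc; have [d' ed] := ncpoly_evaluates X pd.
  have [b1 e1] := ncpoly_evaluates X p1; have [b2 e2] := ncpoly_evaluates X p2.
  have [b3 e3] := ncpoly_evaluates X p3; have [b4 e4] := ncpoly_evaluates X p4.
  have [n1 [d1 j1]] := evaluates_jet e1; have [n2 [d2 j2]] := evaluates_jet e2.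
  have [n3 [d3 j3]] := evaluates_jet e3; have [n4 [d4 j4]] := evaluates_jet e4.
  have <- : c' * rcomm (rcomm (rcomm b1 b2) b3) b4 * d' = 0.
    by rewrite (jet_lie_nilpotent M j1 j2 j3 j4) mulr0 mul0r.
  by apply: evaluates_mul ed; apply: evaluates_mul ec _; do 3!apply: evaluates_comm => //.
- by rewrite -[0]addr0; exact: evaluates_add.
- exact: evaluates_ext ef fh.
Qed.

Lemma prod_th_Q n : \prod_(i < n) th i * Q = Q * \prod_(i < n) th i.
Proof.
elim: n => [|n IH]; first by rewrite big_ord0 mul1r mulr1.
by rewrite big_ord_recr /= -mulrA (thQ M) !mulrA IH.
Qed.

(** Each commutator contributes th th Q; the Q's commute with all th_i and are absorbed on the left
    by PQ = P, hence the factor P. *)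
Lemma evaluates_vprod j :
  exists2 b, evaluates X (vprod j) b & P * b = P * \prod_(i < 2 * j) th i.
Proof.
elim: j => [|j [b eb Pb]].
  by exists 1; [exact: evaluates_one | rewrite big_ord0].
exists (b * (th (2 * j) * th (2 * j).+1 * Q)).
  by apply: evaluates_mul eb _; rewrite -(XX M); apply: evaluates_comm; exact: evaluates_ncx.
have -> : \prod_(i < 2 * j.+1) th i = \prod_(i < 2 * j) th i * th (2 * j) * th (2 * j).+1.
  by rewrite mulnS !big_ord_recr.
rewrite mulrA Pb -{2}(PQ M) -!mulrA; congr (P * _).
by rewrite (thQ M) [th _ * (Q * _)]mulrA (thQ M) -mulrA [LHS]mulrA prod_th_Q -mulrA.
Qed.

Lemma evaluates_v k : exists2 b, evaluates X (v k) b & P * \prod_(i < 2 * k + 3) th i = - b.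
Proof.
have [b eb Pb] := evaluates_vprod k.
exists (b * (th (2 * k) * th (2 * k).+1 * (th (2 * k).+2 * P))).
  have -> : th (2 * k) * th (2 * k).+1 * (th (2 * k).+2 * P) =
      rcomm (rcomm (X (2 * k)) (X (2 * k).+1)) (X (2 * k).+2).
    rewrite (XX M) rcommMl (QX M) rcommMl !(rcomm0 (thX M _ _)).
    by rewrite mulr0 mul0r addr0 mul0r addr0.
  apply: evaluates_mul eb _.
  by apply: evaluates_comm; [apply: evaluates_comm|]; exact: evaluates_ncx.
(* P commutes with the even value b and then passes the last three odd th_i, which yields the sign
   (-1)^3. *)
have [n [d jb]] := evaluates_jet eb; have [bP _ _] := jet_P M jb.
have Pth i : P * th i = - (th i * P) by rewrite (thP M) opprK.
rewrite addn3 !big_ord_recr /= !mulrA -Pb -bP.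
rewrite -!mulrA -mulrN; congr (b * _).
by do 2!rewrite (mulrA P) Pth mulNr -(mulrA (th _) P); rewrite Pth !mulrN opprK.
Qed.

End Conclusion.

Theorem theorem1p1 : forall k : nat, (1 <= k)%N -> ~ T4 (v k).
Proof.
move=> k _ T4v.
(* v_k involves 2k+3 variables, so [top_neq0] for this m concerns exactly the product computed in
   [evaluates_v]. *)
have [R [X [th [Q [P [Y [g M]]]]]]] := exists_extensible_model (2 * k + 3).
have [b eb Pb] := evaluates_v (ext_model M) k.
have b0 := evaluates_uniq eb (T4_evaluates (ext_model M) T4v).
by have := top_neq0 M; rewrite Pb b0 oppr0 eqxx.
Qed.
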